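(* Let $P\subset\mathbb{R}^n$ be a Delone set of finite local complexity. Let $\varphi:\mathbb{R}^n\to\mathbb{R}^n$ be a $C^1$-map whose differential $d\varphi$ is strongly $P$-equivariant and such that for all $r>0$ there exists $r'>0$ such that for all $x\in\mathbb{R}^n$: $B(\varphi(x),r)\cap\varphi(P)\subset\varphi(B(x,r')\cap P)$. Define $\Phi_\varphi:\mathrm{orb}(P)\to\Omega_{\varphi(P)}$ by $\Phi_\varphi(P-x)=\varphi(P)-(\varphi(x)-\varphi(0))$. Then $\Phi_\varphi$ is a uniformly continuous map (with respect to the metric $D$); it thus extends to a continuous map $\Phi_\varphi:\Omega_P\to\Omega_{\varphi(P)}$. If $\varphi(0)=0$ then $\Phi_\varphi(\Xi_P)=\Xi_{\varphi(P)}$. If $\varphi$ is surjective then $\Phi_\varphi:\Omega_P\to\Omega_{\varphi(P)}$ is surjective.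
   Context: $B(x,r)$ is the open ball in $\mathbb{R}^n$ and, for a closed set $P\subset\mathbb{R}^n$, $B_r[P]=B(0,r)\cap P$. $P$ is uniformly discrete if $\inf\{|x-y| : x\neq y\in P\}>0$, relatively dense if there is $r$ such that $B_r[P-x]\ne\emptyset$ for all $x\in\mathbb{R}^n$, and Delone if both. $P$ has finite local complexity if for every $r$ there are only finitely many distinct sets $B_r[P-x]$, $x\in P$. On closed subsets of $\mathbb{R}^n$ put $D(P,Q)=\inf\{\epsilon>0 : d_H(B_{1/\epsilon}[P]\cup\partial B(0,1/\epsilon),\,B_{1/\epsilon}[Q]\cup\partial B(0,1/\epsilon))\le\epsilon\}$, $d_H$ being the Hausdorff distance. $\Omega_P$ is the completion of $\mathrm{orb}(P)=\{P-x : x\in\mathbb{R}^n\}$ with respect to $D$ (a compact space), and $\Xi_P\subset\Omega_P$ (the canonical transversal) is the closure of $\{P-p : p\in P\}$. A function $f$ on $\mathbb{R}^n$ is strongly $P$-equivariant if there is a finite $R$ such that for all $x,y\in\mathbb{R}^n$, $B_R[P-x]=B_R[P-y]$ implies $f(x)=f(y)$. The differential $d\varphi$ is viewed as a function on $\mathbb{R}^n$ with values in linear maps. The map $\Phi_\varphi$ is well defined, i.e. $\varphi(P)-(\varphi(x)-\varphi(0))$ depends only on $P-x$. *)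

(* Defs.v *)
From mathcomp Require Import all_boot all_order all_algebra.
From mathcomp Require Import all_classical all_reals all_analysis.

Set Implicit Arguments.
Unset Strict Implicit.
Unset Printing Implicit Defensive.

Import Order.TTheory GRing.Theory Num.Theory.
Import numFieldNormedType.Exports.

Local Open Scope classical_set_scope.
Local Open Scope ring_scope.

(* MathComp-Analysis equips ['rV[R]_n] with the sup norm, whereas all balls and
   distances below are Euclidean.  The library topology and differential on
   ['rV[R]_n] do not depend on this choice. *)
Definition enorm (R : realType) (n : nat) (x : 'rV[R]_n) : R :=
  Num.sqrt (\sum_(i < n) x 0 i ^+ 2).

Definition eball (R : realType) (n : nat) (x : 'rV[R]_n) (r : R) :
    set 'rV[R]_n :=
  [set y | enorm (y - x) < r].

(* B_r[P] *)
Definition local_patch (R : realType) (n : nat) (r : R) (P : set 'rV[R]_n) :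
    set 'rV[R]_n :=
  eball 0 r `&` P.

(* P - x *)
Definition translate (R : realType) (n : nat) (P : set 'rV[R]_n)
    (x : 'rV[R]_n) : set 'rV[R]_n :=
  [set p - x | p in P].

(* The infimum is taken in the extended reals, so that it is [+oo] when [P] has
   fewer than two points (the real-valued [inf] would give 0). *)
Definition uniformly_discrete (R : realType) (n : nat) (P : set 'rV[R]_n) :=
  (0 < ereal_inf [set e | exists x y,
         [/\ P x, P y, x <> y & e = (enorm (x - y))%:E]])%E.

Definition relatively_dense (R : realType) (n : nat) (P : set 'rV[R]_n) :=
  exists r : R, forall x, local_patch r (translate P x) !=set0.

Definition Delone (R : realType) (n : nat) (P : set 'rV[R]_n) :=
  uniformly_discrete P /\ relatively_dense P.

Definition finite_local_complexity (R : realType) (n : nat)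
    (P : set 'rV[R]_n) :=
  forall r : R, finite_set [set local_patch r (translate P x) | x in P].

Definition frontier (T : topologicalType) (A : set T) : set T :=
  closure A `\` interior A.

Definition edist_to (R : realType) (n : nat) (x : 'rV[R]_n)
    (A : set 'rV[R]_n) : \bar R :=
  ereal_inf [set (enorm (x - a))%:E | a in A].

Definition hausdorff_dist (R : realType) (n : nat) (A B : set 'rV[R]_n) :
    \bar R :=
  maxe (ereal_sup [set edist_to a B | a in A])
       (ereal_sup [set edist_to b A | b in B]).

Definition pattern_dist (R : realType) (n : nat) (P Q : set 'rV[R]_n) : R :=
  inf [set e : R | 0 < e /\
    (hausdorff_dist
       (local_patch e^-1 P `|` frontier (eball 0 e^-1))
       (local_patch e^-1 Q `|` frontier (eball 0 e^-1)) <= e%:E)%E].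

Definition translation_orbit (R : realType) (n : nat) (P : set 'rV[R]_n) :
    set (set 'rV[R]_n) :=
  range (translate P).

(* [X] together with [iota] is a completion of the metric space [(S, d)].  The
   values of [iota] and [d] outside [S] are irrelevant. *)
Definition is_completion (R : realType) (T : Type) (S : set T)
    (d : T -> T -> R) (X : metricType R) (iota : T -> X) :=
  [/\ (forall F : set_system X, ProperFilter F -> cauchy F ->
        exists l : X, F --> l),
      forall a b, S a -> S b -> mdist (iota a) (iota b) = d a b
    & dense (iota @` S)].

Definition is_hull (R : realType) (n : nat) (P : set 'rV[R]_n)
    (Omega : metricType R) (iota : set 'rV[R]_n -> Omega) :=
  is_completion (translation_orbit P) (@pattern_dist R n) iota.

(* The canonical transversal, inside a hull [iota]. *)
Definition canonical_transversal (R : realType) (n : nat) (P : set 'rV[R]_n)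
    (Omega : metricType R) (iota : set 'rV[R]_n -> Omega) : set Omega :=
  closure [set iota (translate P p) | p in P].

Definition strongly_equivariant (R : realType) (n : nat) (T : Type)
    (P : set 'rV[R]_n) (f : 'rV[R]_n -> T) :=
  exists r : R, forall x y,
    local_patch r (translate P x) = local_patch r (translate P y) -> f x = f y.

(* Continuity of the differential is expressed through its matrix. *)
Definition C1 (R : realType) (n : nat) (phi : 'rV[R]_n -> 'rV[R]_n) :=
  (forall x, differentiable phi x) /\
  continuous (jacobian phi).

(* The map P - x |-> phi(P) - (phi(x) - phi(0)) on [translation_orbit P]: some
   [x] with [A = P - x] is chosen by [xget].  Independence of the choice is a
   property of [phi], not of this definition. *)
Definition induced_map (R : realType) (n : nat) (P : set 'rV[R]_n)
    (phi : 'rV[R]_n -> 'rV[R]_n) (A : set 'rV[R]_n) : set 'rV[R]_n :=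
  let x := xget 0 [set x | A = translate P x] in
  translate (phi @` P) (phi x - phi 0).

(* Main.v *)
Require Import Defs.
From mathcomp Require Import all_boot all_order all_algebra.
From mathcomp Require Import all_classical all_reals all_analysis.
From mathcomp Require Import finmap ring lra.

Set Implicit Arguments.
Unset Strict Implicit.
Unset Printing Implicit Defensive.

Import Order.TTheory GRing.Theory Num.Theory.
Import numFieldNormedType.Exports.

Local Open Scope classical_set_scope.
Local Open Scope ring_scope.

(** A translate [P - x] is known on a large ball as soon as one of the finitely
    many large patches of [P] around a point [p] of [P] near [x], and the vector
    [p - x], are known.  Finite local complexity turns closeness for the pattern
    distance into this exact information: two translates that are close for
    [pattern_dist] agree, after a translation by a small vector, on a large ball
    ([pattern_dist_agree]).  Indeed their points are matched up to small errors,
    and the bounded difference vectors of [P] form a finite set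
    ([difference_gap]), so that almost equal differences are equal.  Conversely,
    agreement on a large ball up to a small translation bounds the distance
    ([pattern_dist_le]).

    The equivariance of the differential is used in integrated form: if [P] looks
    the same around [x] and [y], then [phi (x + z) - phi x = phi (y + z) - phi y]
    for all [z] in a ball ([strongly_equivariant_increments]).  Hence [phi @` P]
    looks the same around [phi x] and [phi y]; the covering hypothesis says
    that the points of [phi @` P] near [phi x] come from points of [P] near
    [x] ([agree_image]).  Since only finitely many increment functions occur
    near [P], the small translation is mapped to a uniformly small one.  This gives
    the independence of the choice of [x] ([translate_image_well_defined]) and the
    uniform continuity ([translate_image_uniform]).

    The rest is metric topology.  A uniformly continuous map extends to the
    completion ([completion_extension]), and the hull of [P] is compact because the
    orbit is totally bounded ([orbit_totally_bounded], [completion_compact]).  The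
    extended map thus sends the closure of a set onto the closure of its image
    ([continuous_image_closure]).  Applied to the translates by points of [P] this
    is the assertion on transversals; applied to the whole orbit, whose image is the
    orbit of [phi @` P] when [phi] is surjective, it is surjectivity. *)

(** * The Euclidean norm *)

Lemma sum_sqr_ge0 (R : realType) (n : nat) (x : 'I_n -> R) :
  0 <= \sum_i x i ^+ 2.
Proof. by apply: sumr_ge0 => i _; exact: sqr_ge0. Qed.

(** The discriminant argument: the squares of the numbers
    [(sum b^2) a_i - (sum a b) b_i] have a nonnegative sum. *)
Lemma sum_cauchy_schwarz (R : realType) (n : nat) (a b : 'I_n -> R) :
  (\sum_i a i * b i) ^+ 2 <= (\sum_i a i ^+ 2) * (\sum_i b i ^+ 2).
Proof.
set S := \sum_i a i * b i; set A := \sum_i a i ^+ 2; set B := \sum_i b i ^+ 2.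
have A0 : 0 <= A by exact: sum_sqr_ge0.
have B0 : 0 <= B by exact: sum_sqr_ge0.
have [Bz|Bn] := eqVneq B 0.
  suff -> : S = 0 by rewrite expr0n mulr_ge0.
  apply: big1 => i _; suff -> : b i = 0 by rewrite mulr0.
  move/eqP: Bz; rewrite psumr_eq0; last by move=> ? _; exact: sqr_ge0.
  by move=> /allP /(_ i (mem_index_enum _)) /=; rewrite sqrf_eq0 => /eqP.
have Bp : 0 < B by rewrite lt_neqAle eq_sym Bn.
have : 0 <= \sum_i (B * a i - S * b i) ^+ 2 by exact: sum_sqr_ge0.
have -> : \sum_i (B * a i - S * b i) ^+ 2 = B * (A * B - S ^+ 2).
  rewrite (eq_bigr (fun i => B ^+ 2 * a i ^+ 2 +
     ((- (2 * B * S)) * (a i * b i) + S ^+ 2 * b i ^+ 2))); last first.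
    by move=> i _; ring.
  rewrite big_split big_split /= -!mulr_sumr -/A -/B -/S; ring.
by rewrite pmulr_rge0// subr_ge0.
Qed.

Lemma enorm_ge0 (R : realType) (n : nat) (x : 'rV[R]_n) : 0 <= enorm x.
Proof. exact: sqrtr_ge0. Qed.

Lemma enorm_sqr (R : realType) (n : nat) (x : 'rV[R]_n) :
  enorm x ^+ 2 = \sum_i x 0 i ^+ 2.
Proof. by rewrite /enorm sqr_sqrtr// sum_sqr_ge0. Qed.

Lemma enormD (R : realType) (n : nat) (x y : 'rV[R]_n) :
  enorm (x + y) <= enorm x + enorm y.
Proof.
have xy0 : 0 <= enorm x + enorm y by rewrite addr_ge0 ?enorm_ge0.
rewrite -(@ler_pXn2r _ 2) ?nnegrE ?enorm_ge0//.
rewrite sqrrD !enorm_sqr.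
rewrite (eq_bigr (fun i => x 0 i ^+ 2 + 2 * (x 0 i * y 0 i) + y 0 i ^+ 2)).
  rewrite big_split big_split /= -mulr_sumr lerD2r lerD2l -[leRHS]mulr_natl.
  rewrite ler_pM2l//; apply: le_trans (ler_norm _) _.
  rewrite -(@ler_pXn2r _ 2) ?nnegrE ?mulr_ge0 ?enorm_ge0//.
  rewrite exprMn !enorm_sqr real_normK ?num_real//.
  exact: sum_cauchy_schwarz.
by move=> i _; rewrite mxE; ring.
Qed.

Lemma enormZ (R : realType) (n : nat) (a : R) (x : 'rV[R]_n) :
  enorm (a *: x) = `|a| * enorm x.
Proof.
rewrite /enorm -sqrtr_sqr -sqrtrM ?sqr_ge0//; congr Num.sqrt.
by rewrite mulr_sumr; apply: eq_bigr => i _; rewrite mxE exprMn.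
Qed.

Lemma enormN (R : realType) (n : nat) (x : 'rV[R]_n) : enorm (- x) = enorm x.
Proof. by rewrite -scaleN1r enormZ normrN normr1 mul1r. Qed.

Lemma enorm0 (R : realType) (n : nat) : enorm (0 : 'rV[R]_n) = 0.
Proof. by rewrite -(scale0r (0 : 'rV[R]_n)) enormZ normr0 mul0r. Qed.

Lemma enorm_distC (R : realType) (n : nat) (x y : 'rV[R]_n) :
  enorm (x - y) = enorm (y - x).
Proof. by rewrite -enormN opprB. Qed.

Lemma enormB (R : realType) (n : nat) (x y : 'rV[R]_n) :
  enorm (x - y) <= enorm x + enorm y.
Proof. by rewrite -(enormN y) enormD. Qed.

Lemma enorm_triangle (R : realType) (n : nat) (y x z : 'rV[R]_n) :
  enorm (x - z) <= enorm (x - y) + enorm (y - z).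
Proof. by rewrite (le_trans _ (enormD _ _))// addrA subrK. Qed.

Lemma enorm_le_dist (R : realType) (n : nat) (x y : 'rV[R]_n) :
  enorm x <= enorm y + enorm (x - y).
Proof. by rewrite -{1}(subrK y x) addrC enormD. Qed.

Lemma norm_le_enorm (R : realType) (n : nat) (x : 'rV[R]_n) : `|x| <= enorm x.
Proof.
rewrite [leLHS]/Num.Def.normr /= mx_normrE; apply/bigmax_leP; split=> [|[i j] _ /=].
  exact: enorm_ge0.
rewrite -(@ler_pXn2r _ 2) ?nnegrE ?enorm_ge0// enorm_sqr ord1.
rewrite real_normK ?num_real// (bigD1 j)//= lerDl.
by apply: sumr_ge0 => k _; exact: sqr_ge0.
Qed.

Lemma norm_coord_le (R : realType) (n : nat) (x : 'rV[R]_n) (j : 'I_n) :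
  `|x 0 j| <= `|x|.
Proof.
rewrite [leRHS]/Num.Def.normr /= mx_normrE; apply/bigmax_geP; right.
by exists (0, j).
Qed.

Lemma enorm_le_norm (R : realType) (n : nat) (x : 'rV[R]_n) :
  enorm x <= n%:R * `|x|.
Proof.
have nx0 : 0 <= n%:R * `|x| by rewrite mulr_ge0.
rewrite -(@ler_pXn2r _ 2) ?nnegrE ?enorm_ge0// enorm_sqr.
have [n0|n_gt0] := posnP n.
  by subst n; rewrite big_ord0 sqr_ge0.
apply: (@le_trans _ _ (\sum_(i < n) `|x| ^+ 2)).
  apply: ler_sum => i _; rewrite -[leLHS]real_normK ?num_real//.
  by rewrite ler_pXn2r ?nnegrE// norm_coord_le.
rewrite sumr_const card_ord -[leLHS]mulr_natl exprMn ler_wpM2r ?sqr_ge0//.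
by rewrite expr2 ler_peMr// ler1n.
Qed.

Lemma enorm_eq0 (R : realType) (n : nat) (x : 'rV[R]_n) :
  enorm x = 0 -> x = 0.
Proof.
by move=> x0; apply/eqP; rewrite -normr_le0 -x0 norm_le_enorm.
Qed.

Lemma enorm_ball_nbhs (R : realType) (n : nat) (x : 'rV[R]_n) (e : R) :
  0 < e -> \forall y \near x, enorm (x - y) < e.
Proof.
move=> e0; have d0 : 0 < e / n.+1%:R by rewrite divr_gt0.
near=> y; apply: le_lt_trans (enorm_le_norm _) _.
have : `|x - y| < e / n.+1%:R.
  near: y; exact: cvgr_dist_lt.
rewrite ltr_pdivlMr// mulrC; apply: le_lt_trans.
by rewrite ler_wpM2r// ler_nat.
Unshelve. all: by end_near. Qed.

Lemma nbhs_enormP (R : realType) (n : nat) (x : 'rV[R]_n) (U : set 'rV[R]_n) :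
  nbhs x U -> exists2 e : R, 0 < e & forall y, enorm (x - y) < e -> U y.
Proof.
move=> /nbhs_ballP[e /= e0 eU]; exists e => // y xy; apply: eU.
by rewrite -ball_normE /=; apply: le_lt_trans (norm_le_enorm _) xy.
Qed.

Lemma eball_open (R : realType) (n : nat) (x : 'rV[R]_n) (r : R) :
  open (eball x r).
Proof.
rewrite openE => y /= yr; rewrite /interior.
have d0 : 0 < r - enorm (y - x) by rewrite subr_gt0.
near=> z; rewrite /eball /=.
have : enorm (y - z) < r - enorm (y - x) by near: z; exact: enorm_ball_nbhs.
have := enorm_triangle y z x; rewrite (enorm_distC z y); lra.
Unshelve. all: by end_near. Qed.

Lemma frontier_eball_ge (R : realType) (n : nat) (r : R) (s : 'rV[R]_n) :
  frontier (eball 0 r) s -> r <= enorm s.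
Proof.
rewrite /frontier => -[_]; rewrite leNgt; apply: contra_notN => sr.
have /interior_id -> := @eball_open R n 0 r.
by rewrite /eball /= subr0.
Qed.

Lemma frontier_eball_eq (R : realType) (n : nat) (r : R) (s : 'rV[R]_n) :
  0 < r -> enorm s = r -> frontier (eball 0 r) s.
Proof.
move=> r0 sr; split; last first.
  by move=> /interior_subset; rewrite /eball /= subr0 sr ltxx.
move=> U /nbhs_enormP[e e0 eU].
(* Shrinking [s] slightly moves it inside the open ball. *)
pose t := Num.min (e / (2 * r)) 1.
have t0 : 0 < t by rewrite lt_min ltr01 andbT divr_gt0// mulr_gt0.
have t1 : t <= 1 by rewrite ge_min lexx orbT.
have te : t * r <= e / 2.
  have : t <= e / (2 * r) by rewrite ge_min lexx.
  by rewrite ler_pdivlMr ?mulr_gt0//; lra.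
exists ((1 - t) *: s); split.
  rewrite /eball /= subr0 enormZ sr ger0_norm ?subr_ge0//.
  by have := mulr_gt0 t0 r0; lra.
apply: eU; rewrite -{1}(scale1r s) -scalerBl enormZ sr.
have -> : 1 - (1 - t) = t by ring.
by rewrite gtr0_norm//; lra.
Qed.

(** * Finite local complexity *)

Lemma finite_near (T : choiceType) (I : Type) (D : set T) (F : set_system I)
    (FF : Filter F) (Q : T -> I -> Prop) :
  finite_set D -> (forall x, D x -> \forall i \near F, Q x i) ->
  \forall i \near F, forall x, D x -> Q x i.
Proof.
move=> /finite_fsetP[A ->] FQ.
by have /= := @filter_bigI I T A Q F FF FQ.
Qed.

(** Pointwise form of the equality of two patches of radius [r], see
    [local_patch_translateP]; it is easier to shift and to restrict. *)
Definition agree (R : realType) (n : nat) (P : set 'rV[R]_n) (r : R)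
    (x y : 'rV[R]_n) :=
  forall z, enorm z < r -> (P (x + z) <-> P (y + z)).

Lemma translateE (R : realType) (n : nat) (P : set 'rV[R]_n)
    (x z : 'rV[R]_n) : translate P x z <-> P (x + z).
Proof.
split=> [[p Pp <-]|Pxz]; first by rewrite addrC subrK.
by exists (x + z) => //; rewrite addrC addKr.
Qed.

Lemma local_patch_translateP (R : realType) (n : nat) (P : set 'rV[R]_n)
    (r : R) (x y : 'rV[R]_n) :
  local_patch r (translate P x) = local_patch r (translate P y) <->
  agree P r x y.
Proof.
split=> [e z zr|a].
  have iff_patch u : local_patch r (translate P u) z <-> P (u + z).
    rewrite /local_patch /eball /= subr0; split=> [[_ /translateE//]|Pz].
    by split=> //; apply/translateE.
  by split=> /iff_patch; [rewrite e|rewrite -e] => /iff_patch.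
apply/seteqP; split=> z [zr /translateE Pz]; split=> //; apply/translateE;
  by apply/a => //; move: zr; rewrite /eball /= subr0.
Qed.

Lemma agree_sym (R : realType) (n : nat) (P : set 'rV[R]_n) (r : R)
    (x y : 'rV[R]_n) : agree P r x y -> agree P r y x.
Proof. by move=> a z /a[]. Qed.

Lemma agree_le (R : realType) (n : nat) (P : set 'rV[R]_n) (r s : R)
    (x y : 'rV[R]_n) : s <= r -> agree P r x y -> agree P s x y.
Proof. by move=> sr a z zs; apply: a; exact: lt_le_trans sr. Qed.

Lemma agree_shift (R : realType) (n : nat) (P : set 'rV[R]_n) (r s : R)
    (x y w : 'rV[R]_n) : enorm w + s <= r -> agree P r x y ->
  agree P s (x + w) (y + w).
Proof.
move=> wsr a z zs; rewrite -!addrA; apply: a.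
by apply: le_lt_trans (enormD _ _) _; lra.
Qed.

(** Since there are finitely many patches of radius [M], a property of the points
    of [P] which is inherited by points with the same patch and which holds
    eventually at each point holds eventually uniformly on [P]. *)
Lemma FLC_near (R : realType) (n : nat) (P : set 'rV[R]_n) (M : R) (I : Type)
    (F : set_system I) (FF : Filter F) (Q : 'rV[R]_n -> I -> Prop) :
  finite_local_complexity P ->
  (forall p, P p ->
     \forall i \near F, forall q, P q -> agree P M p q -> Q q i) ->
  \forall i \near F, forall q, P q -> Q q i.
Proof.
move=> flc FQ.
pose D := [set local_patch M (translate P x) | x in P].
have H : \forall i \near F, forall A, D A ->
    forall q, P q -> A = local_patch M (translate P q) -> Q q i.
  apply: finite_near; first exact: flc.
  move=> A [p Pp <-]; near=> i => q Pq /local_patch_translateP; move: q Pq.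
  by near: i; exact: FQ.
apply: filterS H => i Hi q Pq; apply: (Hi (local_patch M (translate P q))) => //.
by exists q.
Unshelve. all: by end_near. Qed.

(** The infimum may be infinite, when [P] has fewer than two points; any positive
    [s] will then do. *)
Lemma uniformly_discrete_gap (R : realType) (n : nat) (P : set 'rV[R]_n) :
  uniformly_discrete P -> exists2 s : R, 0 < s &
    forall x y, P x -> P y -> enorm (x - y) < s -> x = y.
Proof.
rewrite /uniformly_discrete; set E := [set _ | _] => E0.
pose s := if ereal_inf E is r%:E then r else 1%R.
have s0 : 0 < s by move: E0; rewrite /s; case: (ereal_inf E) => //.
exists s => // x y Px Py; apply: contraPP => xy; apply/negP; rewrite -leNgt.
have : (ereal_inf E <= (enorm (x - y))%:E)%E.
  by apply: ereal_inf_lbound; exists x, y.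
by move: E0; rewrite /s; case: (ereal_inf E) => //= [r|]; rewrite ?lee_fin// leye_eq.
Qed.

Lemma closed_ball_compact (R : realType) (n : nat) (x : 'rV[R]_n) (r : R) :
  compact [set y : 'rV[R]_n | `|y - x| <= r].
Proof.
apply: bounded_closed_compact.
  exists (`|x| + r); split; first exact: num_real.
  move=> M xrM y /= yr; rewrite (le_trans _ (ltW xrM))//.
  by rewrite -{1}(subrK x y) (le_trans (ler_normD _ _))// addrC lerD2l.
have c : continuous (fun y : 'rV[R]_n => `|y - x|).
  move=> y; have yx : (fun z : 'rV[R]_n => z - x) @ y --> y - x.
    exact: (cvgB cvg_id (cvg_cst x)).
  exact: cvg_norm yx.
by apply: (@closed_comp _ _ (fun y : 'rV[R]_n => `|y - x|) [set t | t <= r]);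
  [move=> ? _; exact: c|exact: closed_le].
Qed.

(** The Euclidean ball lies in a compact ball of the sup norm, covered by finitely
    many of the open balls of radius [e]. *)
Lemma eball_finite_net (R : realType) (n : nat) (r e : R) : 0 < e ->
  exists2 N : set 'rV[R]_n, finite_set N &
    forall z, enorm z <= r -> exists2 c, N c & enorm (z - c) < e.
Proof.
move=> e0; have := @closed_ball_compact R n 0 r; rewrite compact_cover.
move=> /(_ 'rV[R]_n setT (fun c => eball c e)) [|z _|N _ covN].
- by move=> ? _; exact: eball_open.
- by exists z => //; rewrite /eball /= subrr enorm0.
- exists [set` N]; first exact: finite_fset.
  move=> z zr; have [|c Nc zc] := covN z.
    by rewrite /= subr0 (le_trans (norm_le_enorm _)).
  by exists c.
Qed.

Lemma uniformly_discrete_bounded_finite (R : realType) (n : nat)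
    (P A : set 'rV[R]_n) (r : R) : uniformly_discrete P -> A `<=` P ->
  (forall a, A a -> enorm a <= r) -> finite_set A.
Proof.
move=> /uniformly_discrete_gap[s s0 gapP] AP Ar.
have s20 : 0 < s / 2 by rewrite divr_gt0.
have [N finN netN] := @eball_finite_net R n r _ s20.
(* each ball of the net contains at most one point of [A] *)
apply: (@sub_finite_set _ _
  (\bigcup_(c in N) [set a | A a /\ enorm (a - c) < s / 2])).
  by move=> a Aa; have [c Nc ac] := netN a (Ar a Aa); exists c.
apply: bigcup_finite => // c _.
have [[a [Aa ac]]|none] := pselect (exists a, A a /\ enorm (a - c) < s / 2).
  apply: (@sub_finite_set _ _ [set a]); last exact: finite_set1.
  move=> b [Ab bc]; apply: gapP; [exact: AP|exact: AP|].
  apply: le_lt_trans (enorm_triangle c _ _) _.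
  by rewrite (enorm_distC c) (splitr s) ltrD.
by apply: (@sub_finite_set _ _ set0) => // a Aa; apply: none; exists a.
Qed.

Lemma finite_set_gap (R : realType) (n : nat) (A : set 'rV[R]_n) :
  finite_set A -> exists2 s : R, 0 < s &
    forall x y, A x -> A y -> enorm (x - y) < s -> x = y.
Proof.
move=> finA.
have : \forall s \near 0^'+, forall xy : 'rV[R]_n * 'rV[R]_n,
    (A `*` A) xy -> enorm (xy.1 - xy.2) < s -> xy.1 = xy.2.
  apply: finite_near; first exact: finite_setX.
  move=> [x y] _ /=; have [->|xy] := pselect (x = y); first by near=> s.
  have d0 : 0 < enorm (x - y).
    rewrite lt_neqAle enorm_ge0 andbT eq_sym; apply/eqP => /enorm_eq0/eqP.
    by rewrite subr_eq0 => /eqP.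
  near=> s => xys; exfalso; have : s < enorm (x - y).
    by near: s; exact: nbhs_right_lt.
  lra.
move=> H; near (0 : R)^'+ => s; exists s; first by near: s; exact: nbhs_right_gt.
by move=> x y Ax Ay; apply: (near H s _ (x, y)).
Unshelve. all: by end_near. Qed.

(** The vectors of length less than [M] between two points of [P] all occur in the
    finitely many finite patches of radius [M], so that distinct ones are
    uniformly separated: nearby differences are equal. *)
Lemma difference_gap (R : realType) (n : nat) (P : set 'rV[R]_n) (M : R) :
  uniformly_discrete P -> finite_local_complexity P ->
  exists2 s : R, 0 < s & forall p q u v, P p -> P q -> P (p + u) -> P (q + v) ->
    enorm u < M -> enorm v < M -> enorm (u - v) < s -> u = v.
Proof.
move=> udP flcP.
have [|s s0 gap] := @finite_set_gap R n
  (\bigcup_(A in [set local_patch M (translate P x) | x in P]) A).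
  apply: bigcup_finite; first exact: flcP.
  move=> _ [p Pp <-].
  rewrite (_ : local_patch _ _ =
      (fun a => a - p) @` [set a | P a /\ enorm (a - p) < M]); last first.
    apply/seteqP; split=> [z [zM /translateE Pz]|_ [a [Pa aM] <-]].
      exists (p + z); last by rewrite addrAC subrr add0r.
      by split=> //; move: zM; rewrite /eball /= subr0 addrAC subrr add0r.
    split; first by rewrite /eball /= subr0.
    by exists a.
  apply: finite_image.
  apply: (@uniformly_discrete_bounded_finite _ _ P _ (enorm p + M)) => //.
    by move=> a [].
  move=> a [_ aM]; have := enorm_le_dist a p; lra.
exists s => // p q u v Pp Pq Ppu Pqv uM vM; apply: gap.
  exists (local_patch M (translate P p)); first by exists p.
  by split; [rewrite /eball /= subr0|apply/translateE].
exists (local_patch M (translate P q)); first by exists q.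
by split; [rewrite /eball /= subr0|apply/translateE].
Qed.

(** * The pattern distance *)

Lemma hausdorff_distC (R : realType) (n : nat) (A B : set 'rV[R]_n) :
  hausdorff_dist A B = hausdorff_dist B A.
Proof. by rewrite /hausdorff_dist maxC. Qed.

Lemma hausdorff_dist_le (R : realType) (n : nat) (A B : set 'rV[R]_n) (d : R) :
  (forall a, A a -> exists2 b, B b & enorm (a - b) <= d) ->
  (forall b, B b -> exists2 a, A a & enorm (b - a) <= d) ->
  (hausdorff_dist A B <= d%:E)%E.
Proof.
have one (X Y : set 'rV[R]_n) :
    (forall a, X a -> exists2 b, Y b & enorm (a - b) <= d) ->
    (ereal_sup [set edist_to a Y | a in X] <= d%:E)%E.
  move=> XY; apply: ge_ereal_sup => _ [a Xa <-].
  have [b Yb ab] := XY a Xa; apply: (@le_trans _ _ (enorm (a - b))%:E).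
    by apply: ereal_inf_lbound; exists b.
  by rewrite lee_fin.
by move=> AB BA; rewrite /hausdorff_dist ge_max !one.
Qed.

Lemma hausdorff_dist_lt (R : realType) (n : nat) (A B : set 'rV[R]_n)
    (e d : R) (a : 'rV[R]_n) : (hausdorff_dist A B <= e%:E)%E -> e < d ->
  A a -> exists2 b, B b & enorm (a - b) < d.
Proof.
rewrite /hausdorff_dist ge_max => /andP[AB _] ed Aa.
have : (edist_to a B < d%:E)%E.
  apply: (@le_lt_trans _ _ e%:E); last by rewrite lte_fin.
  by apply: le_trans AB; apply: ereal_sup_ubound; exists a.
move=> /ereal_inf_lt[_ [b Bb <-]]; rewrite lte_fin => ab.
by exists b.
Qed.

Lemma pattern_distC (R : realType) (n : nat) (A B : set 'rV[R]_n) :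
  pattern_dist A B = pattern_dist B A.
Proof.
by rewrite /pattern_dist; congr inf; apply/seteqP;
  split=> e /=; rewrite hausdorff_distC.
Qed.

(** A point of the first patch whose translate leaves the ball of radius [r] is
    within [enorm w] of the sphere; this is what the boundary sphere is for in the
    definition of the distance. *)
Lemma patch_shift_close (R : realType) (n : nat) (A B : set 'rV[R]_n)
    (r e : R) (w : 'rV[R]_n) : enorm w <= e -> enorm w < r ->
  (forall z, enorm z < r -> A z -> B (z + w)) ->
  forall a, (local_patch r A `|` frontier (eball 0 r)) a ->
  exists2 b, (local_patch r B `|` frontier (eball 0 r)) b &
    enorm (a - b) <= e.
Proof.
move=> we wr AB a [[]|fa]; last first.
  exists a; [by right|rewrite subrr enorm0].
  exact: le_trans (enorm_ge0 _) we.
rewrite /eball /= subr0 => ar Aa.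
have [awr|awr] := ltP (enorm (a + w)) r.
  exists (a + w); first by left; split; [rewrite /eball /= subr0|exact: AB].
  by rewrite opprD addNKr enormN.
have tri := enormD a w.
have a0 : 0 < enorm a by lra.
have r0 : 0 < r by exact: le_lt_trans (enorm_ge0 _) wr.
exists ((r / enorm a) *: a).
  right; apply: frontier_eball_eq => //.
  by rewrite enormZ ger0_norm ?divr_ge0 ?enorm_ge0 ?ltW// divfK// gt_eqF.
rewrite -{1}(scale1r a) -scalerBl enormZ distrC ger0_norm; last first.
  by rewrite subr_ge0 ler_pdivlMr// mul1r ltW.
by rewrite mulrBl divfK ?gt_eqF// mul1r; lra.
Qed.

Lemma pattern_dist_le (R : realType) (n : nat) (A B : set 'rV[R]_n) (e : R)
    (w : 'rV[R]_n) : 0 < e -> enorm w <= e -> enorm w < e^-1 ->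
  (forall z, enorm z < e^-1 -> A z -> B (z + w)) ->
  (forall z, enorm z < e^-1 -> B z -> A (z - w)) ->
  pattern_dist A B <= e.
Proof.
move=> e0 we wr AB BA; apply: ge_inf.
  by exists 0 => x /= [/ltW].
split=> //; apply: hausdorff_dist_le; first exact: patch_shift_close AB.
by apply: patch_shift_close BA; rewrite enormN.
Qed.

(** Without this the infimum could be that of the empty set, which is [0]. For
    [0 < n] the two patches of radius [1/2] are joined by the sphere; for
    [n = 0] there is no sphere, but two nonempty sets are equal. *)
Lemma pattern_dist_bounded (R : realType) (n : nat) (A B : set 'rV[R]_n) :
  A !=set0 -> B !=set0 ->
  (hausdorff_dist (local_patch 2^-1 A `|` frontier (eball 0 2^-1))
                  (local_patch 2^-1 B `|` frontier (eball 0 2^-1)) <= 2%:E)%E.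
Proof.
have one (X Y : set 'rV[R]_n) : Y !=set0 ->
    forall a, (local_patch 2^-1 X `|` frontier (eball 0 2^-1)) a ->
    exists2 b, (local_patch 2^-1 Y `|` frontier (eball 0 2^-1)) b &
    enorm (a - b) <= 2.
  move=> [b Yb] a [|fa]; last first.
    by exists a; [right|rewrite subrr enorm0].
  rewrite /local_patch /eball /= subr0 => -[a2 _].
  have [n0|n_gt0] := posnP n.
    have e : a = b by subst n; apply/rowP => -[].
    exists a; last by rewrite subrr enorm0.
    by left; rewrite -e in Yb; split; rewrite //= subr0.
  pose s : 'rV[R]_n := 2^-1 *: delta_mx 0 (Ordinal n_gt0).
  have s2 : enorm s = 2^-1.
    rewrite enormZ ger0_norm ?invr_ge0// /enorm (bigD1 (Ordinal n_gt0))//=.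
    rewrite big1 => [|i /negPf i0]; first by rewrite mxE !eqxx addr0 expr1n sqrtr1 mulr1.
    by rewrite mxE i0 andbF expr0n.
  exists s; first by right; apply: frontier_eball_eq => //; rewrite invr_gt0.
  apply: le_trans (enormB _ _) _; rewrite s2; lra.
by move=> A0 B0; apply: hausdorff_dist_le; exact: one.
Qed.

Lemma pattern_dist_lt (R : realType) (n : nat) (A B : set 'rV[R]_n) (d : R)
    (a : 'rV[R]_n) : pattern_dist A B < d -> A !=set0 -> B !=set0 ->
  A a -> enorm a + d <= d^-1 -> exists2 b, B b & enorm (a - b) < d.
Proof.
move=> ABd A0 B0 Aa ad.
have [|e [e0 ABe] ed] := inf_lt _ ABd.
  by exists 2; split; [|exact: pattern_dist_bounded].
have de : d^-1 < e^-1 by rewrite ltf_pV2 ?posrE//; exact: lt_trans ed.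
have d0 : 0 < d by exact: lt_trans ed.
have [|b Bb ab] := @hausdorff_dist_lt _ _ _ _ _ _ a ABe ed.
  left; split=> //; rewrite /eball /= subr0; lra.
(* [a] is too far from the sphere to be matched with a point on it *)
case: Bb => [[_ Bb]|/frontier_eball_ge eb]; first by exists b.
have := enorm_le_dist b a; rewrite enorm_distC; lra.
Qed.

(** * Close translates agree up to a small translation *)

Lemma relatively_denseP (R : realType) (n : nat) (P : set 'rV[R]_n) :
  relatively_dense P ->
  exists2 r : R, 0 < r & forall x, exists2 p, P p & enorm (p - x) < r.
Proof.
move=> [r rd].
have near_pt x : exists2 p, P p & enorm (p - x) < r.
  have [z [zr [p Pp pE]]] := rd x; exists p => //.
  by move: zr; rewrite -pE /eball /= subr0.
exists r => //; have [p _] := near_pt 0; exact: le_lt_trans (enorm_ge0 _).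
Qed.

(** The points of two close translates are matched up to a small error; once one pair [p], [q] of matched points is fixed, the other matched pairs
    have difference vectors from [p] and from [q] that are almost equal, hence
    equal by [difference_gap]. *)
Lemma pattern_dist_agree (R : realType) (n : nat) (P : set 'rV[R]_n)
    (r M eta : R) : uniformly_discrete P -> finite_local_complexity P ->
  0 < r -> (forall x, exists2 p, P p & enorm (p - x) < r) ->
  0 <= M -> 0 < eta ->
  exists2 d : R, 0 < d & forall x y,
    pattern_dist (translate P x) (translate P y) < d ->
    exists p q, [/\ P p, P q, enorm (p - x) < r,
      enorm ((p - x) - (q - y)) < eta & agree P M p q].
Proof.
move=> udP flcP r0 rd M0 eta0.
have [s s0 gap] := difference_gap (M + 1) udP flcP.
have rM0 : 0 < r + M + 2 by lra.
have [D [D0 De Ds D1 DrM]] : exists D : R,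
    [/\ 0 < D, D <= eta, D <= s / 2, D <= 2^-1 & r + M + 2 <= D^-1].
  exists (Num.min (Num.min eta (s / 2)) (Num.min 2^-1 (r + M + 2)^-1)).
  have D0 : 0 < Num.min (Num.min eta (s / 2)) (Num.min 2^-1 (r + M + 2)^-1).
    by rewrite !lt_min eta0 divr_gt0//= !invr_gt0 ltr0n rM0.
  split=> //; rewrite -?[r + M + 2 <= _]lef_pV2 ?posrE ?invr_gt0// ?invrK;
    by rewrite !ge_min lexx ?orbT.
have ne z : translate P z !=set0.
  by have [p Pp _] := rd 0; exists (p - z), p.
have half x' y' p q z :
    pattern_dist (translate P x') (translate P y') < D -> P p -> P q ->
    enorm (p - x') < r + D -> enorm ((p - x') - (q - y')) < D ->
    enorm z < M -> P (p + z) -> P (q + z).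
  move=> xy' Pp Pq px pq zM Ppz.
  have axz : translate P x' (p - x' + z).
    by apply/translateE; rewrite addrA addrCA subrr addr0.
  have := pattern_dist_lt xy' (ne _) (ne _) axz; move=> {xy'} match_z.
  have [|b' /translateE Pb' pzb] := match_z.
    by have := enormD (p - x') z; lra.
  have zv : enorm (z - (y' + b' - q)) < 2 * D.
    rewrite (_ : _ - _ = (p - x' + z - b') - (p - x' - (q - y'))); last first.
      by apply/rowP => i; rewrite !mxE; ring.
    have := enormB (p - x' + z - b') (p - x' - (q - y')); lra.
  suff -> : z = y' + b' - q by rewrite addrC subrK.
  apply: (gap p q) => //; rewrite ?[q + _]addrC ?subrK//; try lra.
  have := enorm_le_dist (y' + b' - q) z.
  rewrite (enorm_distC (y' + b' - q)); lra.
exists D => // x y xyD; have yxD := xyD; rewrite pattern_distC in yxD.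
have [p Pp px] := rd x.
have [||b /translateE Pb pb] := pattern_dist_lt xyD (ne _) (ne _) (a := p - x).
- by exists p.
- by move=> {xyD yxD}; lra.
have bE : y + b - y = b by rewrite addrAC subrr add0r.
exists p, (y + b); rewrite bE; split=> //; first by move=> {xyD yxD}; lra.
move=> z zM; split.
  apply: (half x y _ _ _ xyD Pp Pb) => //; rewrite ?bE//.
  by move=> {xyD yxD}; lra.
apply: (half y x _ _ _ yxD Pb Pp); rewrite ?bE// {xyD yxD}.
  by have := enorm_le_dist b (p - x); rewrite (enorm_distC b); lra.
by rewrite enorm_distC.
Qed.

(** A translate [P - (p + z)] with [p] in [P]
    and [enorm z] bounded is determined, up to a small distance, by one of the
    finitely many large patches at [p] and by [z] up to a small error. *)
Lemma orbit_totally_bounded (R : realType) (n : nat) (P : set 'rV[R]_n) (e : R) :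
  relatively_dense P -> finite_local_complexity P -> 0 < e ->
  exists2 N : set (set 'rV[R]_n), finite_set N & N `<=` translation_orbit P /\
    forall A, translation_orbit P A -> exists2 B, N B & pattern_dist A B <= e.
Proof.
move=> /relatively_denseP[r r0 rd] flcP e0.
have ei0 : 0 < e^-1 by rewrite invr_gt0.
pose eta := Num.min e (e^-1 / 2).
have eta0 : 0 < eta by rewrite lt_min e0 divr_gt0.
have eta_e : eta <= e by rewrite ge_min lexx.
have eta_ei : eta < e^-1.
  have : eta <= e^-1 / 2 by rewrite ge_min lexx orbT.
  lra.
pose M := e^-1 + r + e^-1.
have [N2 finN2 netN2] := @eball_finite_net R n r _ eta0.
pose D := [set local_patch M (translate P x) | x in P].
pose rep (A : set 'rV[R]_n) :=
  xget 0 [set p | P p /\ local_patch M (translate P p) = A].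
have repP p : P p -> P (rep (local_patch M (translate P p))) /\
    agree P M (rep (local_patch M (translate P p))) p.
  move=> Pp; rewrite /rep; case: xgetP => [q _ [Pq]|none].
    by move=> /local_patch_translateP.
  by exfalso; apply: (none p).
exists [set translate P u | u in [set q + c | q in rep @` D & c in N2]].
  apply: finite_image; apply: finite_image2 => //.
  by apply: finite_image; exact: flcP.
split=> [_ [u _ <-]|_ [x _ <-]]; first by exists u.
have [p Pp px] := rd x.
have [|c N2c zc] := netN2 (x - p); first by rewrite enorm_distC ltW.
have [q Dq [_ pq]] : exists2 q : 'rV[R]_n, (rep @` D) q & P q /\ agree P M q p.
  exists (rep (local_patch M (translate P p))); last exact: repP.
  by exists (local_patch M (translate P p)) => //; exists p.
exists (translate P (q + c)).
  by exists (q + c) => //; exists q => //; exists c.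
rewrite enorm_distC in px.
apply: (@pattern_dist_le _ _ _ _ _ ((x - p) - c)) => //; try lra.
  move=> v ve /translateE Pxv; apply/translateE.
  have -> : q + c + (v + (x - p - c)) = q + (x - p + v).
    by apply/rowP => i; rewrite !mxE; ring.
  apply/pq; first by have := enormD (x - p) v; rewrite /M; lra.
  by rewrite addrA [p + _]addrC subrK.
move=> v ve /translateE Pqv; apply/translateE.
have -> : x + (v - (x - p - c)) = p + (c + v).
  by apply/rowP => i; rewrite !mxE; ring.
apply/pq; last by rewrite addrA.
have := enormD c v; have := enorm_le_dist c (x - p).
rewrite (enorm_distC c) /M; lra.
Qed.

(** * Maps with strongly pattern-equivariant differential *)

(** Along the segment from [0] to [z], each coordinate of
    [phi (x + t z) - phi (y + t z)] has derivative zero. *)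
Lemma eq_diff_eq_increment (R : realType) (n : nat)
    (phi : 'rV[R]_n -> 'rV[R]_n) (r : R) (x y : 'rV[R]_n) :
  (forall u, differentiable phi u) ->
  (forall z, enorm z < r ->
    ('d phi (x + z) : 'rV[R]_n -> 'rV[R]_n) = 'd phi (y + z)) ->
  forall z, enorm z < r -> phi (x + z) - phi x = phi (y + z) - phi y.
Proof.
move=> dphi eqd z zr.
pose line (u : 'rV[R]_n) : R -> 'rV[R]_n := cst u + ( *:%R^~ z).
have diff_line u (t : R) : is_diff t (line u) ( *:%R^~ z).
  rewrite -[X in is_diff _ _ X]add0r; exact: is_diffD.
have diff_phi u : is_diff u phi ('d phi u) by exact: DiffDef.
apply/rowP => i; rewrite !mxE.
pose h u : R -> 'rV[R]_n := phi \o line u.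
have diff_h u t : is_diff t (h u) ('d phi (line u t) \o ( *:%R^~ z)).
  exact: (@is_diff_comp R _ _ _ (line u) _ phi _ t (diff_line u t) (diff_phi _)).
pose g u (t : R) : R := h u t 0 i.
have derg u (t : R) : is_derive t (1 : R) (g u) ('d phi (line u t) z 0 i).
  have dh : derivable (h u) t (1 : R) by apply: diff_derivable; exact: ex_diff.
  apply: DeriveDef; first exact: (derivable_mxP _ _ _).1.
  transitivity ('D_(1 : R) (h u) t 0 i); first by rewrite derive_mx// mxE.
  by rewrite deriveE ?diff_val//= ?scale1r//; exact: ex_diff.
have cont_g u : continuous (g u).
  move=> t; apply: differentiable_continuous; apply/derivable1_diffP.
  exact: ex_derive.
have [|||t tI] := @MVT_segment R (g x - g y) (fun=> 0) 0 1.
- exact: ler01.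
- move=> t; rewrite in_itv /= => /andP[t0 t1].
  have eqt : ('d phi (line x t) : 'rV[R]_n -> 'rV[R]_n) = 'd phi (line y t).
    apply: eqd; rewrite enormZ gtr0_norm//; apply: le_lt_trans zr.
    by rewrite ler_piMl ?enorm_ge0// ltW.
  have eqz := congr1 (fun f : 'rV[R]_n -> 'rV[R]_n => f z 0 i) eqt.
  apply: (is_derive_eq (is_deriveB (derg x t) (derg y t))).
  by apply/eqP; rewrite subr_eq0; apply/eqP; exact: eqz.
- apply: continuous_subspaceT => t.
  exact: (@cvgB _ _ _ _ _ (g x) (g y) _ _ (cont_g x t) (cont_g y t)).
- rewrite mul0r /g /h /line !fctE /= !scale1r !scale0r !addr0; lra.
Qed.

(** Integrated form of the equivariance of the differential. The radius [r + R0]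
    is needed because ['d phi] at [x + z] is determined by [P] within distance
    [R0] of [x + z]. *)
Definition increments_equivariant (R : realType) (n : nat) (P : set 'rV[R]_n)
    (phi : 'rV[R]_n -> 'rV[R]_n) (R0 : R) :=
  forall r x y, agree P (r + R0) x y ->
  forall z, enorm z < r -> phi (x + z) - phi x = phi (y + z) - phi y.

Lemma strongly_equivariant_increments (R : realType) (n : nat)
    (P : set 'rV[R]_n) (phi : 'rV[R]_n -> 'rV[R]_n) :
  (forall u, differentiable phi u) ->
  strongly_equivariant P (fun x => ('d phi x : 'rV[R]_n -> 'rV[R]_n)) ->
  exists2 R0 : R, 0 <= R0 & increments_equivariant P phi R0.
Proof.
move=> dphi [s eqv]; exists (Num.max s 0); first by rewrite le_max lexx orbT.
move=> r x y xy; apply: (eq_diff_eq_increment dphi) => z zr.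
apply: (eqv (x + z) (y + z)); apply/local_patch_translateP.
by apply: agree_shift xy; apply: lerD; [exact: ltW|rewrite le_max lexx].
Qed.

Lemma continuous_locally_uniform (R : realType) (n : nat)
    (phi : 'rV[R]_n -> 'rV[R]_n) (p : 'rV[R]_n) (r e : R) :
  continuous phi -> 0 < e ->
  \forall eta \near 0^'+, forall z z', enorm z < r -> enorm (z - z') < eta ->
    enorm (phi (p + z) - phi (p + z')) < e.
Proof.
move=> cphi e0.
have /compact_near_coveringP/(_ _ (0 : R)^'+) := @closed_ball_compact R n p r.
move=> /(_ (fun eta u => forall u', enorm (u - u') < eta ->
  enorm (phi u - phi u') < e) _) H.
have : \forall eta \near 0^'+, forall u : 'rV[R]_n, `|u - p| <= r ->
    forall u', enorm (u - u') < eta -> enorm (phi u - phi u') < e.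
  apply: H => u _.
  have e20 : 0 < e / 2 by rewrite divr_gt0.
  have [d d0 dP] := nbhs_enormP (cphi u _ (enorm_ball_nbhs (phi u) e20)).
  have d20 : 0 < d / 2 by rewrite divr_gt0.
  exists ([set v | enorm (u - v) < d / 2], [set eta | eta < d / 2]).
    by split; [exact: enorm_ball_nbhs|exact: nbhs_right_lt].
  move=> [v eta] [/= uv eta_d] v' vv'.
  have uv' : enorm (u - v') < d.
    apply: le_lt_trans (enorm_triangle v _ _) _; lra.
  have h1 := dP v' uv'; have h2 : enorm (phi u - phi v) < e / 2 by apply: dP; lra.
  apply: le_lt_trans (enorm_triangle (phi u) _ _) _.
  rewrite (enorm_distC (phi v)); rewrite /= in h1; lra.
apply: filterS => eta Heta z z' zr zz'; apply: Heta.
  rewrite addrAC subrr add0r; apply: le_trans (norm_le_enorm _) _; exact: ltW.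
by rewrite opprD addrACA subrr add0r.
Qed.

Lemma continuous_locally_bounded (R : realType) (n : nat)
    (phi : 'rV[R]_n -> 'rV[R]_n) (p : 'rV[R]_n) (r : R) :
  continuous phi ->
  \forall C \near +oo, forall z, enorm z < r -> enorm (phi (p + z) - phi p) < C.
Proof.
move=> cphi.
have /compact_near_coveringP/(_ _ (pinfty_nbhs R)) := @closed_ball_compact R n p r.
move=> /(_ (fun C u => enorm (phi u - phi p) < C) _) H.
have : \forall C \near +oo, forall u : 'rV[R]_n, `|u - p| <= r ->
    enorm (phi u - phi p) < C.
  apply: H => u _.
  exists ([set v | enorm (phi u - phi v) < 1],
          [set C | 1 + enorm (phi u - phi p) < C]).
    split; last by apply: nbhs_pinfty_gt; exact: num_real.
    exact: (cphi u _ (enorm_ball_nbhs (phi u) ltr01)).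
  move=> [v C] [/= uv uC]; apply: le_lt_trans (enorm_triangle (phi u) _ _) _.
  rewrite (enorm_distC (phi v)); lra.
apply: filterS => C HC z zr; apply: HC.
by rewrite addrAC subrr add0r; apply: le_trans (norm_le_enorm _) _; exact: ltW.
Qed.

(** [phi] is uniformly continuous near [P], and its increments near [P] are
    bounded: there are only finitely many local increment functions of [phi],
    each of them continuous on a compact ball. *)
Lemma uniform_increments (R : realType) (n : nat) (P : set 'rV[R]_n)
    (phi : 'rV[R]_n -> 'rV[R]_n) (R0 r e : R) :
  finite_local_complexity P -> continuous phi ->
  increments_equivariant P phi R0 -> 0 < e ->
  exists eta C : R, [/\ 0 < eta,
    forall p z z', P p -> enorm z < r -> enorm z' < r -> enorm (z - z') < eta ->
      enorm (phi (p + z) - phi (p + z')) < e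
    & forall p z, P p -> enorm z < r -> enorm (phi (p + z) - phi p) < C].
Proof.
move=> flcP cphi incr e0.
have Hu : \forall eta \near 0^'+, forall p, P p -> forall z z', enorm z < r ->
    enorm z' < r -> enorm (z - z') < eta ->
    enorm (phi (p + z) - phi (p + z')) < e.
  apply: (FLC_near (M := r + R0)) => // p Pp.
  apply: filterS (continuous_locally_uniform p r cphi e0) => eta Heta q Pq pq.
  move=> z z' zr z'r zz'; suff -> : phi (q + z) - phi (q + z') =
      phi (p + z) - phi (p + z') by exact: Heta.
  have := incr _ _ _ pq z zr; have := incr _ _ _ pq z' z'r.
  move=> /eqP; rewrite subr_eq => /eqP -> /eqP; rewrite subr_eq => /eqP ->.
  by apply/rowP => i; rewrite !mxE; ring.
have Hb : \forall C \near +oo, forall p, P p -> forall z, enorm z < r ->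
    enorm (phi (p + z) - phi p) < C.
  apply: (FLC_near (M := r + R0)) => // p Pp.
  apply: filterS (continuous_locally_bounded p r cphi) => C HC q Pq pq z zr.
  by rewrite -(incr _ _ _ pq z zr); exact: HC.
near (0 : R)^'+ => eta; near (pinfty_nbhs R) => C; exists eta, C; split.
- by near: eta; exact: nbhs_right_gt.
- by move=> p z z' Pp; apply: (near Hu eta).
- by move=> p z Pp; apply: (near Hb C).
Unshelve. all: by end_near. Qed.

(** Equal translates agree at every radius, so that all increments of [phi] from
    [x] and from [y] are equal. *)
Lemma translate_image_well_defined (R : realType) (n : nat) (P : set 'rV[R]_n)
    (phi : 'rV[R]_n -> 'rV[R]_n) (R0 : R) (x y : 'rV[R]_n) :
  increments_equivariant P phi R0 -> translate P x = translate P y ->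
  translate (phi @` P) (phi x - phi 0) = translate (phi @` P) (phi y - phi 0).
Proof.
move=> incr exy.
have sub x' y' : translate P x' = translate P y' ->
    translate (phi @` P) (phi x' - phi 0) `<=` translate (phi @` P) (phi y' - phi 0).
  move=> e _ [_ [p Pp <-] <-].
  have Pq : P (y' + (p - x')) by apply/translateE; rewrite -e; exists p.
  exists (phi (y' + (p - x'))); first by exists (y' + (p - x')).
  have ag : agree P (enorm (p - x') + 1 + R0) x' y'.
    by apply/local_patch_translateP; rewrite e.
  have := incr _ _ _ ag (p - x'); rewrite ltrDl ltr01 [x' + _]addrC subrK => /(_ isT).
  move=> /eqP; rewrite subr_eq => /eqP ->.
  by apply/rowP => i; rewrite !mxE; ring.
by apply/seteqP; split; exact: sub.
Qed.

(** Large agreeing patches of [P] yield agreeing patches of [phi @` P]: by the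
    covering hypothesis, a point of [phi @` P] close to [phi p] is the image of a
    point of [P] at bounded distance from [p]. *)
Lemma agree_image (R : realType) (n : nat) (P : set 'rV[R]_n)
    (phi : 'rV[R]_n -> 'rV[R]_n) (R0 r : R) :
  (forall r : R, 0 < r -> exists r' : R, 0 < r' /\
     forall x, eball (phi x) r `&` (phi @` P) `<=` phi @` (eball x r' `&` P)) ->
  0 <= R0 -> increments_equivariant P phi R0 -> 0 < r ->
  exists2 M : R, 0 <= M & forall p q, agree P M p q ->
    agree (phi @` P) r (phi p) (phi q).
Proof.
move=> proper R00 incr r0; have [r' [r'0 Hr']] := proper r r0.
exists (r' + R0); first by rewrite addr_ge0// ltW.
have half p q z : agree P (r' + R0) p q -> enorm z < r ->
    (phi @` P) (phi p + z) -> (phi @` P) (phi q + z).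
  move=> pq zr pz; have [|u [up Pu] uE] := Hr' p (phi p + z).
    by split=> //; rewrite /eball /= addrAC subrr add0r.
  have ur : enorm (u - p) < r' + R0 by rewrite (lt_le_trans up)// lerDl.
  exists (q + (u - p)).
    by apply/(pq _ ur); rewrite addrC subrK.
  have := incr _ _ _ pq (u - p) up; rewrite [p + _]addrC subrK uE.
  rewrite addrAC subrr add0r => /eqP; rewrite eq_sym subr_eq => /eqP ->.
  by rewrite addrC.
move=> p q pq z zr; split; apply: half => //; exact: agree_sym.
Qed.

(** Let [p] and [q] be matched points of [P] near [x] and [y].  Around [phi p] and
    [phi q] the set [phi @` P] looks the same, so the translates at [x] and at [y]
    agree on a large ball up to the vector
    [(phi x - phi p) - (phi y - phi q)].  As [phi] has the same increments from
    [p] as from [q], this vector is an increment of [phi] between two very close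
    points near [q]. *)
Lemma translate_image_uniform (R : realType) (n : nat) (P : set 'rV[R]_n)
    (phi : 'rV[R]_n -> 'rV[R]_n) (R0 e : R) :
  Delone P -> finite_local_complexity P -> continuous phi ->
  (forall r : R, 0 < r -> exists r' : R, 0 < r' /\
     forall x, eball (phi x) r `&` (phi @` P) `<=` phi @` (eball x r' `&` P)) ->
  0 <= R0 -> increments_equivariant P phi R0 -> 0 < e ->
  exists2 d : R, 0 < d & forall x y,
    pattern_dist (translate P x) (translate P y) < d ->
    pattern_dist (translate (phi @` P) (phi x - phi 0))
                 (translate (phi @` P) (phi y - phi 0)) <= e.
Proof.
move=> [udP /relatively_denseP[r0 r00 rd]] flcP cphi proper R00 incr e0.
have ei0 : 0 < e^-1 by rewrite invr_gt0.
have e'0 : 0 < Num.min e e^-1 by rewrite lt_min e0.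
have [eta [C [eta0 unif bdd]]] := uniform_increments (r0 + 1) flcP cphi incr e'0.
have [p0 Pp0 _] := rd 0.
have C0 : 0 <= C.
  apply: ltW; apply: le_lt_trans (enorm_ge0 _) (bdd p0 0 Pp0 _).
  by rewrite enorm0 addr_gt0.
have r_gt0 : 0 < e^-1 + C + enorm (phi 0) by have := enorm_ge0 (phi 0); lra.
have [M1 M10 agim] := agree_image proper R00 incr r_gt0.
(* [M1] makes the images agree, [r0 + 1 + R0] makes the increments of [phi]
   from [p] and [q] agree up to the points [x] and [y]. *)
pose M := Num.max M1 (r0 + 1 + R0).
have M0 : 0 <= M by rewrite le_max M10.
have M1M : M1 <= M by rewrite le_max lexx.
have M2M : r0 + 1 + R0 <= M by rewrite le_max lexx orbT.
have eta1 : 0 < Num.min eta 1 by rewrite lt_min eta0 ltr01.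
have [d d0 Hd] := pattern_dist_agree udP flcP r00 rd M0 eta1.
exists d => // x y /Hd[p [q [Pp Pq px ab pq]]].
pose a := p - x; pose b := q - y.
have ar : enorm (- a) < r0 + 1 by rewrite enormN; apply: lt_trans px _; lra.
have ab_eta : enorm (a - b) < eta by move: ab; rewrite lt_min => /andP[].
have ab1 : enorm (a - b) < 1 by move: ab; rewrite lt_min => /andP[].
have br : enorm (- b) < r0 + 1.
  rewrite enormN; have := enorm_le_dist b a; rewrite (enorm_distC b) -/a in px *.
  by move=> h; lra.
have xE : x = p - a by rewrite /a opprB addrC subrK.
have yE : y = q - b by rewrite /b opprB addrC subrK.
have px_qx : phi x - phi p = phi (q - a) - phi q.
  by rewrite xE; apply: (incr _ _ _ (agree_le M2M pq)).
pose w := (phi x - phi p) - (phi y - phi q).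
have wE : w = phi (q - a) - phi (q - b).
  rewrite /w px_qx yE; by apply/rowP => i; rewrite !mxE; ring.
have wlt : enorm w < Num.min e e^-1.
  rewrite wE; apply: unif => //.
  by rewrite -opprD enormN.
move: wlt; rewrite lt_min => /andP[we wei].
have small z : enorm z < e^-1 ->
    enorm (phi x - phi p - phi 0 + z) < e^-1 + C + enorm (phi 0).
  move=> ze; have h1 : enorm (phi x - phi p) < C by rewrite xE; apply: bdd.
  have h2 := enormB (phi x - phi p) (phi 0).
  have := enormD (phi x - phi p - phi 0) z; lra.
have smally z : enorm z < e^-1 ->
    enorm (phi y - phi q - phi 0 + z) < e^-1 + C + enorm (phi 0).
  move=> ze; have h1 : enorm (phi y - phi q) < C by rewrite yE; apply: bdd.
  have h2 := enormB (phi y - phi q) (phi 0).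
  have := enormD (phi y - phi q - phi 0) z; lra.
have pq' := agim _ _ (agree_le M1M pq).
apply: (pattern_dist_le e0 (ltW we) wei) => z ze /translateE Pz.
  apply/translateE; have := (pq' _ (small z ze)).1.
  rewrite (_ : phi p + _ = phi x - phi 0 + z); last first.
    by apply/rowP => i; rewrite !mxE; ring.
  move=> /(_ Pz); congr (_ _); rewrite /w; by apply/rowP => i; rewrite !mxE; ring.
apply/translateE; have := (pq' _ (smally z ze)).2.
rewrite (_ : phi q + _ = phi y - phi 0 + z); last first.
  by apply/rowP => i; rewrite !mxE; ring.
move=> /(_ Pz); congr (_ _); rewrite /w; by apply/rowP => i; rewrite !mxE; ring.
Qed.

(** * Completions *)

Lemma completion_approx (R : realType) (T : Type) (S : set T) (d : T -> T -> R)
    (X : metricType R) (iota : T -> X) : is_completion S d iota ->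
  forall z (e : R), 0 < e -> exists2 a, S a & mdist z (iota a) < e.
Proof.
move=> [_ _ dns] z e e0.
have [|y [ze [a Sa aE]]] := dns (ball z e)° _ (open_interior _).
  by exists z; apply: nbhsx_ballx.
by exists a => //; have := interior_subset ze; rewrite -aE ballEmdist.
Qed.

(** The value at [z] is the limit of the values at points of [S] tending to [z];
    these values form a Cauchy filter by uniform continuity. *)
Lemma completion_extension (R : realType) (T : Type) (S : set T)
    (d : T -> T -> R) (X : metricType R) (iota : T -> X) (Y : metricType R)
    (f : T -> Y) : is_completion S d iota ->
  (forall F : set_system Y, ProperFilter F -> cauchy F ->
    exists l : Y, F --> l) ->
  (forall e : R, 0 < e -> exists2 r : R, 0 < r & forall a b, S a -> S b ->
    d a b < r -> mdist (f a) (f b) < e) ->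
  exists2 g : X -> Y, continuous g & forall a, S a -> g (iota a) = f a.
Proof.
move=> cX cY unif.
have approx := completion_approx cX.
have [_ isoX _] := cX.
pose is_value z w := forall e : R, 0 < e -> exists2 r : R, 0 < r &
  forall a, S a -> mdist z (iota a) < r -> mdist w (f a) < e.
have value z : exists w, is_value z w.
  pose F := filter_from [set r : R | 0 < r]
    (fun r => f @` [set a | S a /\ mdist z (iota a) < r]).
  have FF : ProperFilter F.
    apply: filter_from_proper.
      apply: filter_from_filter; first by exists 1 => /=.
      move=> r s /= r0 s0; exists (Num.min r s); first by rewrite /= lt_min r0.
      move=> _ [a [Sa zrs] <-]; move: zrs; rewrite lt_min => /andP[zr zs].
      by split; exists a.
    move=> r /= r0; have [a Sa za] := approx z r r0.
    by exists (f a), a.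
  have cF : cauchy F.
    apply: cauchy_exP => e e0; have [r r0 fr] := unif e e0.
    have r20 : 0 < r / 2 by rewrite divr_gt0.
    have [b Sb zb] := approx z _ r20.
    exists (f b); exists (r / 2) => // _ [a [Sa za] <-].
    rewrite ballEmdist /=; apply: fr => //; rewrite -isoX//.
    apply: le_lt_trans (metric_triangle _ z _) _.
    by rewrite (metric_sym _ z); lra.
  have [w Fw] := cY F FF cF; exists w => e e0.
  have [r r0 rw] := Fw _ (nbhsx_ballx w e e0).
  exists r => // a Sa za; have : ball w e (f a) by apply: rw; exists a.
  by rewrite ballEmdist.
pose g z := projT1 (cid (value z)).
have gP z : is_value z (g z) := projT2 (cid (value z)).
exists g.
  move=> z; apply/metricType_numDomainType.cvgrPdist_lt => e e0.
  have e20 : 0 < e / 2 by rewrite divr_gt0.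
  have [r r0 zr] := gP z _ e20.
  apply/metricType_numDomainType.nbhs_mdistP; exists r => // z' zz' /=.
  have [r' r'0 zr'] := gP z' _ e20.
  have s0 : 0 < Num.min r' (r - mdist z z') by rewrite lt_min r'0 subr_gt0.
  have [a Sa] := approx z' _ s0; rewrite lt_min => /andP[z'a z'a'].
  have h1 := zr' a Sa z'a; have h2 : mdist (g z) (f a) < e / 2.
    apply: zr => //; apply: le_lt_trans (metric_triangle _ z' _) _; lra.
  apply: le_lt_trans (metric_triangle _ (f a) _) _.
  by rewrite (metric_sym (f a)); lra.
move=> a Sa; apply: mdist_positivity; apply/eqP.
rewrite eq_le mdist_ge0 andbT; apply/ler_addgt0Pl => e e0; rewrite addr0.
have [r r0 ar] := gP (iota a) e e0.
by apply/ltW/ar => //; rewrite mdistxx.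
Qed.

Lemma ultrafilter_finite_cover (X : Type) (I : choiceType) (F : set_system X)
    (N : set I) (U : I -> set X) : UltraFilter F -> finite_set N ->
  (forall x, exists2 i, N i & U i x) -> exists2 i, N i & F (U i).
Proof.
move=> UF finN cov; apply: contrapT => none.
have FU : F [set x | forall i, N i -> ~ U i x].
  apply: (@finite_near I X N F _ (fun i x => ~ U i x)) => // i Ni.
  by have [Fi|//] := in_ultra_setVsetC (U i) UF; exfalso; apply: none; exists i.
have [x xU] := filter_ex FU; have [i Ni Uix] := cov x; exact: xU Uix.
Qed.

(** In the completion of a totally bounded space every ultrafilter contains
    arbitrarily small balls, hence is Cauchy and converges. *)
Lemma completion_compact (R : realType) (T : choiceType) (S : set T)
    (d : T -> T -> R) (X : metricType R) (iota : T -> X) :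
  is_completion S d iota ->
  (forall e : R, 0 < e -> exists2 N : set T, finite_set N & N `<=` S /\
    forall a, S a -> exists2 b, N b & d a b <= e) ->
  compact [set: X].
Proof.
move=> cX tb; rewrite compact_ultra => F UF _.
have approx := completion_approx cX; have [complX isoX _] := cX.
have cF : cauchy F.
  apply: cauchy_exP => e e0; have e40 : 0 < e / 4 by rewrite divr_gt0.
  have [N finN [NS netN]] := tb _ e40.
  have [|b Nb Fb] := @ultrafilter_finite_cover X T F N
      (fun b => ball (iota b) e) UF finN; last by exists (iota b).
  move=> z; have [a Sa za] := approx z _ e40.
  have [b Nb ab] := netN a Sa; exists b => //; rewrite ballEmdist /=.
  rewrite -isoX in ab => //; last exact: NS.
  rewrite metric_sym; apply: le_lt_trans (metric_triangle _ (iota a) _) _; lra.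
by have [l Fl] := complX F _ cF; exists l.
Qed.

(** The image of the compact set [closure A] is closed. *)
Lemma continuous_image_closure (X Y : topologicalType) (g : X -> Y) (A : set X) :
  compact [set: X] -> hausdorff_space Y -> continuous g ->
  g @` closure A = closure (g @` A).
Proof.
move=> cX hY cg; apply/seteqP; split.
  move=> _ [x Ax <-] U /cg gU; have [y [Ay Uy]] := Ax _ gU.
  by exists (g y); split=> //; exists y.
have cl : closed (g @` closure A).
  apply: compact_closed => //; apply: continuous_compact.
    exact: continuous_subspaceT.
  by apply: (subclosed_compact _ cX) => //; exact: closed_closure.
rewrite [X in _ `<=` X](closure_id _).1//; apply: closure_subset.
by move=> _ [x Ax <-]; exists x => //; exact: subset_closure.
Qed.

(** * The induced map between hulls *)

Theorem theorem4p8 (R : realType) (n : nat) (P : set 'rV[R]_n)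
    (phi : 'rV[R]_n -> 'rV[R]_n)
    (P_Delone : Delone P)
    (P_FLC : finite_local_complexity P)
    (phi_C1 : C1 phi)
    (dphi_equivariant : strongly_equivariant P
       (fun x => ('d phi x : 'rV[R]_n -> 'rV[R]_n)))
    (phi_proper : forall r : R, 0 < r -> exists r' : R, 0 < r' /\
       forall x, eball (phi x) r `&` (phi @` P) `<=`
                 phi @` (eball x r' `&` P))
    (OmegaP : metricType R) (iotaP : set 'rV[R]_n -> OmegaP)
    (OmegaP_hull : is_hull P iotaP)
    (OmegaQ : metricType R) (iotaQ : set 'rV[R]_n -> OmegaQ)
    (OmegaQ_hull : is_hull (phi @` P) iotaQ) :
  let Phi := induced_map P phi in
  [/\ forall x, Phi (translate P x) =
                translate (phi @` P) (phi x - phi 0),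
      forall e : R, 0 < e -> exists d : R, 0 < d /\
        forall A B, translation_orbit P A -> translation_orbit P B ->
          pattern_dist A B < d -> pattern_dist (Phi A) (Phi B) < e
    & exists PhiX : OmegaP -> OmegaQ,
        [/\ continuous PhiX,
            forall A, translation_orbit P A -> PhiX (iotaP A) = iotaQ (Phi A),
            phi 0 = 0 ->
              PhiX @` canonical_transversal P iotaP = canonical_transversal (phi @` P) iotaQ
          & (forall y, exists x, phi x = y) -> forall w, exists z, PhiX z = w]].
Proof.
move=> Phi; have [dphi _] := phi_C1.
have cphi : continuous phi by move=> x; exact: differentiable_continuous.
have [R0 R00 incr] := strongly_equivariant_increments dphi dphi_equivariant.
have PhiE x : Phi (translate P x) = translate (phi @` P) (phi x - phi 0).
  rewrite /Phi /induced_map; case: xgetP => [y _ yE|none].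
    by apply: translate_image_well_defined incr _.
  by exfalso; apply: (none x).
have PhiU (e : R) : 0 < e -> exists2 d : R, 0 < d & forall A B,
    translation_orbit P A -> translation_orbit P B -> pattern_dist A B < d ->
    pattern_dist (Phi A) (Phi B) < e.
  move=> e0; have e20 : 0 < e / 2 by rewrite divr_gt0.
  have [d d0 Hd] := translate_image_uniform P_Delone P_FLC cphi phi_proper R00
    incr e20.
  exists d => // _ _ [x _ <-] [y _ <-] /Hd xy; rewrite !PhiE.
  by apply: le_lt_trans xy _; rewrite ltr_pdivrMr// ltr_pMr// ltr1n.
have Phi_orbit A : translation_orbit P A -> translation_orbit (phi @` P) (Phi A).
  by move=> [x _ <-]; rewrite PhiE; exists (phi x - phi 0).
split=> //; first by move=> e /PhiU[d d0 Hd]; exists d.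
have [complQ isoQ densQ] := OmegaQ_hull.
have [|g cg gE] := completion_extension (f := iotaQ \o Phi) OmegaP_hull complQ.
  move=> e /PhiU[d d0 Hd]; exists d => // A B oA oB AB /=.
  by rewrite isoQ; [exact: Hd|exact: Phi_orbit|exact: Phi_orbit].
have cptP : compact [set: OmegaP].
  apply: completion_compact OmegaP_hull _ => e e0.
  by apply: orbit_totally_bounded => //; exact: P_Delone.2.
have hausQ : hausdorff_space OmegaQ := @metric_hausdorff _ _.
exists g; split=> //.
  move=> phi0; rewrite /canonical_transversal continuous_image_closure//.
  congr closure; rewrite !image_comp; apply: eq_imagel => p Pp /=.
  by rewrite gE /= ?PhiE ?phi0 ?subr0//; exists p.
move=> phi_surj w.
have sub : iotaQ @` translation_orbit (phi @` P) `<=`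
    g @` (iotaP @` translation_orbit P).
  (* the translate of [phi @` P] by [y] is the image of [P - x] when
     [phi x = y + phi 0] *)
  move=> _ [_ [y _ <-] <-]; have [x xE] := phi_surj (y + phi 0).
  exists (iotaP (translate P x)); first by exists (translate P x) => //; exists x.
  by rewrite gE /= ?PhiE ?xE ?addrK//; exists x.
have : (g @` closure (iotaP @` translation_orbit P)) w.
  rewrite continuous_image_closure//; apply: closure_subset sub _ _.
  move=> U wU; have [|y [Uy Sy]] := densQ U° _ (open_interior _).
    by exists w.
  by exists y; split=> //; exact: interior_subset.
by move=> [z _ <-]; exists z.
Qed.
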